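(* Let a line congruence be given by $f(x,y)=(x,y,0)$ and $\xi(x,y)=(\xi^1(x,y),\xi^2(x,y),1)$ and put $$W= (\xi^2_y-\xi^1_x)(\xi^2_{xx}\xi^1_{yy}-\xi^1_{xx}\xi^2_{yy})-2\xi^1_y(\xi^1_{xx}\xi^2_{xy}-\xi^2_{xx}\xi^1_{xy})+2\xi^2_x(\xi^1_{xy}\xi^2_{yy}-\xi^1_{yy}\xi^2_{xy}).$$ At a regular point, the line congruence is Weingarten if and only if $W=0$.
   Context: A line congruence is given by smooth maps $f(x,y)=(x,y,0)$, $\xi(x,y)=(\xi^1(x,y),\xi^2(x,y),1)$ on an open set $\mathcal D\subset\mathbb R^2$: its lines pass through $f(x,y)$ with direction $\xi(x,y)$. Its shape operator is $S=\begin{pmatrix} a&b\\ c&d\end{pmatrix}$ with $a=-\xi^1_x$, $b=-\xi^1_y$, $c=-\xi^2_x$, $d=-\xi^2_y$; its discriminant is $\delta=(a-d)^2+4bc$. The eigenvalues of $S$ are $\lambda_1=\frac12(a+d+\sqrt\delta)$, $\lambda_2=\frac12(a+d-\sqrt\delta)$; they are assumed nonzero (all considerations are local). The focal sets are $E_i=f+\frac1{\lambda_i}\xi$, $i=1,2$. A point is regular if it is not a discriminant point ($\delta\ne0$; the principal directions being real, $\delta>0$) and neither focal set is singular there (each $E_i$ is an immersion at the point). The conformal class of the projective metric of $E_i$ is that of the quadratic form $v\mapsto \det\big((E_i)_x,(E_i)_y,D^2E_i(v,v)\big)$ on the parameter plane. The congruence is Weingarten at a regular point if the projective metrics of $E_1$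 and $E_2$ are conformal there, i.e. these two quadratic forms (compared through the common parameter $(x,y)$) are nonzero scalar multiples of each other. *)

(* Defs.v *)
From Stdlib Require Import Reals.
From Coquelicot Require Import Coquelicot.
Open Scope R_scope.

Definition Dx (g : R -> R -> R) (x y : R) : R := Derive (fun t => g t y) x.
Definition Dy (g : R -> R -> R) (x y : R) : R := Derive (fun t => g x t) y.

(* C^infinity: [ex_diff_n g n x y] says that all iterated partial derivatives
   of order at most n exist and are continuous at (x, y). *)
Definition smooth_on (D : R * R -> Prop) (g : R -> R -> R) : Prop :=
  forall (n : nat) (x y : R), D (x, y) -> ex_diff_n g n x y.

Definition vec3 : Type := (R * R * R)%type.

Definition det3 (u v w : vec3) : R :=
  let '(u1, u2, u3) := u in
  let '(v1, v2, v3) := v in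
  let '(w1, w2, w3) := w in
  u1 * (v2 * w3 - v3 * w2) - u2 * (v1 * w3 - v3 * w1)
  + u3 * (v1 * w2 - v2 * w1).

Definition VDx (F : R -> R -> vec3) (x y : R) : vec3 :=
  (Dx (fun u v => fst (fst (F u v))) x y,
   Dx (fun u v => snd (fst (F u v))) x y,
   Dx (fun u v => snd (F u v)) x y).
Definition VDy (F : R -> R -> vec3) (x y : R) : vec3 :=
  (Dy (fun u v => fst (fst (F u v))) x y,
   Dy (fun u v => snd (fst (F u v))) x y,
   Dy (fun u v => snd (F u v)) x y).

Definition immersion_at (F : R -> R -> vec3) (x y : R) : Prop :=
  forall s t : R,
    plus (scal s (VDx F x y)) (scal t (VDy F x y)) = (0, 0, 0) ->
    s = 0 /\ t = 0.

Definition second_diff (F : R -> R -> vec3) (x y : R) (v : R * R) : vec3 :=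
  plus (scal (fst v ^ 2) (VDx (VDx F) x y))
    (plus (scal (2 * fst v * snd v) (VDy (VDx F) x y))
          (scal (snd v ^ 2) (VDy (VDy F) x y))).

(* A representative of the conformal class of the projective metric of F. *)
Definition proj_metric (F : R -> R -> vec3) (x y : R) (v : R * R) : R :=
  det3 (VDx F x y) (VDy F x y) (second_diff F x y v).

Definition conformal_at (F G : R -> R -> vec3) (x y : R) : Prop :=
  exists k : R, k <> 0 /\
    forall v : R * R, proj_metric F x y v = k * proj_metric G x y v.

(* [xi1] and [xi2] are the components xi^1 and xi^2 of the direction map. *)

Definition base_map (x y : R) : vec3 := (x, y, 0).
Definition dir_map (xi1 xi2 : R -> R -> R) (x y : R) : vec3 :=
  (xi1 x y, xi2 x y, 1).

(* Entries of the shape operator ((Sa, Sb), (Sc, Sd)). *)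
Definition Sa (xi1 xi2 : R -> R -> R) (x y : R) : R := - Dx xi1 x y.
Definition Sb (xi1 xi2 : R -> R -> R) (x y : R) : R := - Dy xi1 x y.
Definition Sc (xi1 xi2 : R -> R -> R) (x y : R) : R := - Dx xi2 x y.
Definition Sd (xi1 xi2 : R -> R -> R) (x y : R) : R := - Dy xi2 x y.

Definition discr (xi1 xi2 : R -> R -> R) (x y : R) : R :=
  (Sa xi1 xi2 x y - Sd xi1 xi2 x y) ^ 2 + 4 * Sb xi1 xi2 x y * Sc xi1 xi2 x y.

(* [sqrt] is 0 on negative reals: these are the eigenvalues of the shape
   operator only where [discr] is nonnegative. *)
Definition lambda1 (xi1 xi2 : R -> R -> R) (x y : R) : R :=
  / 2 * (Sa xi1 xi2 x y + Sd xi1 xi2 x y + sqrt (discr xi1 xi2 x y)).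
Definition lambda2 (xi1 xi2 : R -> R -> R) (x y : R) : R :=
  / 2 * (Sa xi1 xi2 x y + Sd xi1 xi2 x y - sqrt (discr xi1 xi2 x y)).

Definition focal1 (xi1 xi2 : R -> R -> R) (x y : R) : vec3 :=
  plus (base_map x y) (scal (1 / lambda1 xi1 xi2 x y) (dir_map xi1 xi2 x y)).
Definition focal2 (xi1 xi2 : R -> R -> R) (x y : R) : vec3 :=
  plus (base_map x y) (scal (1 / lambda2 xi1 xi2 x y) (dir_map xi1 xi2 x y)).

Definition regular_point (xi1 xi2 : R -> R -> R) (x y : R) : Prop :=
  0 < discr xi1 xi2 x y /\
  immersion_at (focal1 xi1 xi2) x y /\
  immersion_at (focal2 xi1 xi2) x y.

Definition weingarten_at (xi1 xi2 : R -> R -> R) (x y : R) : Prop :=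
  conformal_at (focal1 xi1 xi2) (focal2 xi1 xi2) x y.

Definition W (xi1 xi2 : R -> R -> R) (x y : R) : R :=
  (Dy xi2 x y - Dx xi1 x y)
    * (Dx (Dx xi2) x y * Dy (Dy xi1) x y - Dx (Dx xi1) x y * Dy (Dy xi2) x y)
  - 2 * Dy xi1 x y
    * (Dx (Dx xi1) x y * Dy (Dx xi2) x y - Dx (Dx xi2) x y * Dy (Dx xi1) x y)
  + 2 * Dx xi2 x y
    * (Dy (Dx xi1) x y * Dy (Dy xi2) x y - Dy (Dy xi1) x y * Dy (Dx xi2) x y).

(* Main.v *)
From Stdlib Require Import Reals Lra.
From Coquelicot Require Import Coquelicot.
Require Import Defs.
Open Scope R_scope.

(** Let [S] be the shape operator. Where the discriminant is positive, [S] has a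
    basis of principal directions [r], [s], for the eigenvalues [l1], [l2], and
    all the objects are simple in that basis.

    Modulo the direction of the line, the differential of a focal set
    [f + xi / l] is [1 - S / l], which kills the principal direction of [l]. For
    the first sheet its image is the line of [s], so the projective metric only
    sees the component transverse to [s] of the second differential, and the
    second derivatives of the eigenvalue disappear from it. The first
    derivatives of the eigenvalue are found by differentiating the characteristic
    equation ([diff1_root]): they are [B1(v, r)], where [B1] is the component
    transverse to [s] of the second differential of the direction map. For
    [v] with principal coordinates [(a, b)] the metric of the first sheet is then
    a multiple of [b^2 B1(s, s) - a^2 B1(r, r)] ([proj_metric_focal]), and the
    metric of the second sheet is, likewise, a multiple of
    [b^2 B2(s, s) - a^2 B2(r, r)], where [B2] is the component transverse to [r].

    A focal set is singular when its focal distance is stationary along its own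
    principal direction, so regularity gives that [B1(r, r)] and [B2(s, s)] do
    not vanish ([immersion_curv]). Hence neither metric is zero, and they are
    conformal if and only if [B1(r, r) B2(s, s) - B1(s, s) B2(r, r)] vanishes
    ([proportional_diagonal_forms]). This number times [l1 - l2] is [W]
    ([W_principal]).

    The eigenvalues are given by a square root; the closure of the functions of
    class C^n under sums, products, inverses and square roots shows that they
    are of class C^2, which the rules for second derivatives need. *)

(** * Functions of class C^n near a point *)

(** Regularity is required on a whole neighbourhood, since a second partial
    derivative at one point already involves first derivatives at nearby
    points. *)
Definition Cn_near (n : nat) (g : R -> R -> R) (x y : R) : Prop :=
  locally_2d (fun u v => ex_diff_n g n u v) x y.

Lemma locally_2d_strengthen (P Q : R -> R -> Prop) :
  (forall x y, locally_2d P x y -> Q x y) ->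
  forall x y, locally_2d P x y -> locally_2d Q x y.
Proof.
  intros H x y; apply locally_2d_impl_strong, locally_2d_forall; exact H.
Qed.

Lemma locally_2d_weaken (P Q : R -> R -> Prop) x y :
  (forall u v, P u v -> Q u v) -> locally_2d P x y -> locally_2d Q x y.
Proof.
  intros H; apply locally_2d_impl, locally_2d_forall; exact H.
Qed.

Lemma Cn_near_le n m g x y :
  (m <= n)%nat -> Cn_near n g x y -> Cn_near m g x y.
Proof.
  intros Hm; apply locally_2d_weaken; intros u v; apply ex_diff_n_m; exact Hm.
Qed.

Lemma Cn_near_ext n f g x y :
  locally_2d (fun u v => f u v = g u v) x y ->
  Cn_near n f x y -> Cn_near n g x y.
Proof.
  intros He Hf.
  refine (locally_2d_strengthen _ _ _ x y (locally_2d_and _ _ x y He Hf)).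
  intros u v H; apply (ex_diff_n_ext_loc f).
  - revert H; apply locally_2d_weaken; tauto.
  - apply locally_2d_singleton in H; tauto.
Qed.

Lemma Cn_near_continuity n g x y :
  Cn_near n g x y -> continuity_2d_pt g x y.
Proof.
  intros H; apply locally_2d_singleton in H; destruct n; apply H.
Qed.

Lemma Cn_near_ex_derive n g x y :
  Cn_near (S n) g x y ->
  ex_derive (fun t => g t y) x /\ ex_derive (fun t => g x t) y.
Proof.
  intros H; apply locally_2d_singleton in H; split; apply H.
Qed.

Lemma Cn_near_Dx n g x y : Cn_near (S n) g x y -> Cn_near n (Dx g) x y.
Proof.
  apply locally_2d_weaken; intros u v H; apply H.
Qed.

Lemma Cn_near_Dy n g x y : Cn_near (S n) g x y -> Cn_near n (Dy g) x y.
Proof.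
  apply locally_2d_weaken; intros u v H; apply H.
Qed.

Lemma Cn_near_0 g x y :
  locally_2d (fun u v => continuity_2d_pt g u v) x y -> Cn_near 0 g x y.
Proof.
  apply locally_2d_weaken; intros u v H; split; [exact H | exact I].
Qed.

(** The inductive step shared by the closure properties below: a formula for
    the partial derivatives that is valid near the point reduces class C^(n+1)
    to class C^n of the terms of that formula. *)
Lemma Cn_near_S n g gx gy x y :
  locally_2d (fun u v => continuity_2d_pt g u v /\
    is_derive (fun t => g t v) u (gx u v) /\
    is_derive (fun t => g u t) v (gy u v)) x y ->
  Cn_near n gx x y -> Cn_near n gy x y -> Cn_near (S n) g x y.
Proof.
  intros H Hx Hy.
  assert (Ex : Cn_near n (Dx g) x y).
  { revert Hx; apply Cn_near_ext; revert H; apply locally_2d_weaken.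
    intros u v (_ & H & _); symmetry; apply is_derive_unique, H. }
  assert (Ey : Cn_near n (Dy g) x y).
  { revert Hy; apply Cn_near_ext; revert H; apply locally_2d_weaken.
    intros u v (_ & _ & H); symmetry; apply is_derive_unique, H. }
  generalize (locally_2d_and _ _ x y H (locally_2d_and _ _ x y Ex Ey)).
  apply locally_2d_weaken; intros u v ((Hc & Hdx & Hdy) & H1 & H2).
  split; [exact Hc | split; [| split; [| split]]].
  - exists (gx u v); exact Hdx.
  - exists (gy u v); exact Hdy.
  - exact H1.
  - exact H2.
Qed.

Lemma Cn_near_const n c x y : Cn_near n (fun _ _ => c) x y.
Proof.
  revert c x y; induction n as [| n IH]; intros c x y.
  - apply Cn_near_0, locally_2d_forall; intros u v; apply continuity_2d_pt_const.
  - apply (Cn_near_S n _ (fun _ _ => 0) (fun _ _ => 0)); [| apply IH | apply IH].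
    apply locally_2d_forall; intros u v; split; [| split].
    + apply continuity_2d_pt_const.
    + apply @is_derive_const.
    + apply @is_derive_const.
Qed.

Lemma is_derive_Dx n g x y :
  ex_diff_n g (S n) x y -> is_derive (fun t => g t y) x (Dx g x y).
Proof. intros H; apply Derive_correct, H. Qed.

Lemma is_derive_Dy n g x y :
  ex_diff_n g (S n) x y -> is_derive (fun t => g x t) y (Dy g x y).
Proof. intros H; apply Derive_correct, H. Qed.

Lemma Cn_near_plus n f g x y :
  Cn_near n f x y -> Cn_near n g x y ->
  Cn_near n (fun u v => f u v + g u v) x y.
Proof.
  revert f g; induction n as [| n IH]; intros f g Hf Hg;
    pose proof (locally_2d_and _ _ x y Hf Hg) as Hfg.
  - apply Cn_near_0; revert Hfg; apply locally_2d_weaken; intros u v [H1 H2].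
    apply continuity_2d_pt_plus; [apply H1 | apply H2].
  - apply (Cn_near_S n _ (fun u v => Dx f u v + Dx g u v)
                         (fun u v => Dy f u v + Dy g u v)).
    + revert Hfg; apply locally_2d_weaken; intros u v [H1 H2]; split; [| split].
      * apply continuity_2d_pt_plus; [apply H1 | apply H2].
      * apply @is_derive_plus; apply (is_derive_Dx n); assumption.
      * apply @is_derive_plus; apply (is_derive_Dy n); assumption.
    + apply IH; apply Cn_near_Dx; assumption.
    + apply IH; apply Cn_near_Dy; assumption.
Qed.

Lemma Cn_near_mult n f g x y :
  Cn_near n f x y -> Cn_near n g x y ->
  Cn_near n (fun u v => f u v * g u v) x y.
Proof.
  revert f g; induction n as [| n IH]; intros f g Hf Hg;
    pose proof (locally_2d_and _ _ x y Hf Hg) as Hfg.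
  - apply Cn_near_0; revert Hfg; apply locally_2d_weaken; intros u v [H1 H2].
    apply continuity_2d_pt_mult; [apply H1 | apply H2].
  - assert (Hf' : Cn_near n f x y) by (apply (Cn_near_le (S n)); auto).
    assert (Hg' : Cn_near n g x y) by (apply (Cn_near_le (S n)); auto).
    apply (Cn_near_S n _ (fun u v => Dx f u v * g u v + f u v * Dx g u v)
                         (fun u v => Dy f u v * g u v + f u v * Dy g u v)).
    + revert Hfg; apply locally_2d_weaken; intros u v [H1 H2]; split; [| split].
      * apply continuity_2d_pt_mult; [apply H1 | apply H2].
      * apply (is_derive_mult (fun t => f t v) (fun t => g t v)).
        apply (is_derive_Dx n); assumption.
        apply (is_derive_Dx n); assumption.
        intros; apply Rmult_comm.
      * apply (is_derive_mult (fun t => f u t) (fun t => g u t)).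
        apply (is_derive_Dy n); assumption.
        apply (is_derive_Dy n); assumption.
        intros; apply Rmult_comm.
    + apply Cn_near_plus; apply IH; trivial; apply Cn_near_Dx; assumption.
    + apply Cn_near_plus; apply IH; trivial; apply Cn_near_Dy; assumption.
Qed.

Lemma Cn_near_opp n g x y :
  Cn_near n g x y -> Cn_near n (fun u v => - g u v) x y.
Proof.
  intros Hg; apply (Cn_near_ext _ (fun u v => -1 * g u v)).
  - apply locally_2d_forall; intros u v; ring.
  - apply Cn_near_mult; [apply Cn_near_const | exact Hg].
Qed.

Lemma Cn_near_inv n g x y :
  g x y <> 0 -> Cn_near n g x y -> Cn_near n (fun u v => / g u v) x y.
Proof.
  intros H0; revert n; induction n as [| n IH]; intros Hg;
    pose proof (continuity_2d_pt_neq_0 g x y (Cn_near_continuity _ _ _ _ Hg) H0)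
      as Hn;
    pose proof (locally_2d_and _ _ x y Hg Hn) as Hgn.
  - apply Cn_near_0; revert Hgn; apply locally_2d_weaken; intros u v [H1 H2].
    apply continuity_2d_pt_inv; [apply H1 | exact H2].
  - assert (Hi : Cn_near n (fun u v => / g u v) x y).
    { apply IH, (Cn_near_le (S n)); auto. }
    apply (Cn_near_S n _ (fun u v => -1 * (Dx g u v * (/ g u v * / g u v)))
                         (fun u v => -1 * (Dy g u v * (/ g u v * / g u v)))).
    + revert Hgn; apply locally_2d_weaken; intros u v [H1 H2]; split; [| split].
      * apply continuity_2d_pt_inv; [apply H1 | exact H2].
      * replace (-1 * (Dx g u v * (/ g u v * / g u v)))
          with (- Dx g u v / g u v ^ 2) by (field; exact H2).
        apply (is_derive_inv (fun t => g t v)); [apply (is_derive_Dx n) |]; assumption.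
      * replace (-1 * (Dy g u v * (/ g u v * / g u v)))
          with (- Dy g u v / g u v ^ 2) by (field; exact H2).
        apply (is_derive_inv (fun t => g u t)); [apply (is_derive_Dy n) |]; assumption.
    + repeat apply Cn_near_mult; trivial.
      * apply Cn_near_const.
      * apply Cn_near_Dx, Hg.
    + repeat apply Cn_near_mult; trivial.
      * apply Cn_near_const.
      * apply Cn_near_Dy, Hg.
Qed.

Lemma continuity_2d_pt_pos g x y :
  continuity_2d_pt g x y -> 0 < g x y -> locally_2d (fun u v => 0 < g u v) x y.
Proof.
  intros Hc H0; apply locally_2d_locally.
  apply continuity_2d_pt_filterlim in Hc.
  apply (Hc (fun z => 0 < z)), (open_gt 0), H0.
Qed.

Lemma Cn_near_sqrt n g x y :
  0 < g x y -> Cn_near n g x y -> Cn_near n (fun u v => sqrt (g u v)) x y.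
Proof.
  intros H0; revert n; induction n as [| n IH]; intros Hg;
    pose proof (continuity_2d_pt_pos g x y (Cn_near_continuity _ _ _ _ Hg) H0)
      as Hn;
    pose proof (locally_2d_and _ _ x y Hg Hn) as Hgn.
  - apply Cn_near_0; revert Hgn; apply locally_2d_weaken; intros u v [H1 H2].
    apply (continuity_1d_2d_pt_comp sqrt); [| apply H1].
    apply continuity_pt_sqrt; lra.
  - assert (Hi : Cn_near n (fun u v => / (2 * sqrt (g u v))) x y).
    { apply Cn_near_inv.
      - pose proof (sqrt_lt_R0 _ H0); lra.
      - apply Cn_near_mult; [apply Cn_near_const |].
        apply IH, (Cn_near_le (S n)); auto. }
    apply (Cn_near_S n _ (fun u v => Dx g u v * / (2 * sqrt (g u v)))
                         (fun u v => Dy g u v * / (2 * sqrt (g u v)))).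
    + revert Hgn; apply locally_2d_weaken; intros u v [H1 H2]; split; [| split].
      * apply (continuity_1d_2d_pt_comp sqrt); [| apply H1].
        apply continuity_pt_sqrt; lra.
      * apply (is_derive_sqrt (fun t => g t v));
          [apply (is_derive_Dx n) |]; assumption.
      * apply (is_derive_sqrt (fun t => g u t));
          [apply (is_derive_Dy n) |]; assumption.
    + apply Cn_near_mult; [apply Cn_near_Dx, Hg | exact Hi].
    + apply Cn_near_mult; [apply Cn_near_Dy, Hg | exact Hi].
Qed.

Lemma Dx_Dy_comm g x y : Cn_near 2 g x y -> Dx (Dy g) x y = Dy (Dx g) x y.
Proof.
  intros H; apply Schwarz.
  - revert H; apply locally_2d_weaken; intros u v (_ & H1 & H2 & H3 & H4).
    repeat split; trivial; [apply H4 | apply H3].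
  - apply (Cn_near_continuity 0), Cn_near_Dx, Cn_near_Dy, H.
  - apply (Cn_near_continuity 0), Cn_near_Dy, Cn_near_Dx, H.
Qed.

Lemma Dx_near f g x y :
  locally_2d (fun u v => f u v = g u v) x y -> Dx f x y = Dx g x y.
Proof.
  intros H; apply (Derive_ext_loc (fun t => f t y) (fun t => g t y)).
  apply (locally_2d_1d_const_y (fun u v => f u v = g u v)), H.
Qed.

Lemma Dy_near f g x y :
  locally_2d (fun u v => f u v = g u v) x y -> Dy f x y = Dy g x y.
Proof.
  intros H; apply (Derive_ext_loc (fun t => f x t) (fun t => g x t)).
  apply (locally_2d_1d_const_x (fun u v => f u v = g u v)), H.
Qed.

Lemma Dx_plus f g x y : Cn_near 1 f x y -> Cn_near 1 g x y ->
  Dx (fun u v => f u v + g u v) x y = Dx f x y + Dx g x y.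
Proof.
  intros Hf Hg; exact (Derive_plus (fun t => f t y) (fun t => g t y) x
    (proj1 (Cn_near_ex_derive _ _ _ _ Hf)) (proj1 (Cn_near_ex_derive _ _ _ _ Hg))).
Qed.

Lemma Dy_plus f g x y : Cn_near 1 f x y -> Cn_near 1 g x y ->
  Dy (fun u v => f u v + g u v) x y = Dy f x y + Dy g x y.
Proof.
  intros Hf Hg; exact (Derive_plus (fun t => f x t) (fun t => g x t) y
    (proj2 (Cn_near_ex_derive _ _ _ _ Hf)) (proj2 (Cn_near_ex_derive _ _ _ _ Hg))).
Qed.

Lemma Dx_mult f g x y : Cn_near 1 f x y -> Cn_near 1 g x y ->
  Dx (fun u v => f u v * g u v) x y = Dx f x y * g x y + f x y * Dx g x y.
Proof.
  intros Hf Hg; exact (Derive_mult (fun t => f t y) (fun t => g t y) x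
    (proj1 (Cn_near_ex_derive _ _ _ _ Hf)) (proj1 (Cn_near_ex_derive _ _ _ _ Hg))).
Qed.

Lemma Dy_mult f g x y : Cn_near 1 f x y -> Cn_near 1 g x y ->
  Dy (fun u v => f u v * g u v) x y = Dy f x y * g x y + f x y * Dy g x y.
Proof.
  intros Hf Hg; exact (Derive_mult (fun t => f x t) (fun t => g x t) y
    (proj2 (Cn_near_ex_derive _ _ _ _ Hf)) (proj2 (Cn_near_ex_derive _ _ _ _ Hg))).
Qed.

Lemma Dx_const c x y : Dx (fun _ _ => c) x y = 0.
Proof. exact (Derive_const c x). Qed.

Lemma Dy_const c x y : Dy (fun _ _ => c) x y = 0.
Proof. exact (Derive_const c y). Qed.

(** * Second-order jet of a surface meeting the lines at height m *)

Definition sheet (xi1 xi2 m : R -> R -> R) (x y : R) : vec3 :=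
  plus (base_map x y) (scal (m x y) (dir_map xi1 xi2 x y)).

(** One coordinate of a map [base + m * direction]; the coordinates differ only
    in the linear function [h] and the direction component [p]. *)
Definition along (h m p : R -> R -> R) (u v : R) : R := h u v + m u v * p u v.

Section Along.

Variables (h m p : R -> R -> R) (x y hx hy : R).
Hypothesis Dh : forall u v,
  is_derive (fun t => h t v) u hx /\ is_derive (fun t => h u t) v hy.
Hypotheses (Hm : Cn_near 2 m x y) (Hp : Cn_near 2 p x y).

Let C1 g : Cn_near 2 g x y -> Cn_near 1 g x y.
Proof. apply Cn_near_le; auto. Qed.

Lemma along_near :
  locally_2d (fun u v =>
    Dx (along h m p) u v
      = hx + (Dx m u v * p u v + m u v * Dx p u v) /\
    Dy (along h m p) u v
      = hy + (Dy m u v * p u v + m u v * Dy p u v)) x y.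
Proof.
  generalize (locally_2d_and _ _ x y Hm Hp); apply locally_2d_weaken.
  intros u v [H1 H2]; split; apply is_derive_unique.
  - apply @is_derive_plus; [apply Dh |].
    apply (is_derive_mult (fun t => m t v) (fun t => p t v)).
    + apply (is_derive_Dx 1), H1.
    + apply (is_derive_Dx 1), H2.
    + intros; apply Rmult_comm.
  - apply @is_derive_plus; [apply Dh |].
    apply (is_derive_mult (fun t => m u t) (fun t => p u t)).
    + apply (is_derive_Dy 1), H1.
    + apply (is_derive_Dy 1), H2.
    + intros; apply Rmult_comm.
Qed.

Lemma Dx_along :
  Dx (along h m p) x y = hx + (Dx m x y * p x y + m x y * Dx p x y).
Proof. apply (locally_2d_singleton _ _ _ along_near). Qed.

Lemma Dy_along :
  Dy (along h m p) x y = hy + (Dy m x y * p x y + m x y * Dy p x y).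
Proof. apply (locally_2d_singleton _ _ _ along_near). Qed.

Ltac C1_tac :=
  repeat first [ apply Cn_near_const | apply Cn_near_plus | apply Cn_near_mult
               | apply C1; assumption | apply Cn_near_Dx; assumption
               | apply Cn_near_Dy; assumption ].

Lemma DxDx_along :
  Dx (Dx (along h m p)) x y
  = Dx (Dx m) x y * p x y + 2 * Dx m x y * Dx p x y + m x y * Dx (Dx p) x y.
Proof.
  rewrite (Dx_near _ (fun u v => hx + (Dx m u v * p u v + m u v * Dx p u v))).
  - rewrite (Dx_plus (fun _ _ => hx)) by C1_tac.
    rewrite Dx_plus by C1_tac; rewrite !Dx_mult by C1_tac.
    rewrite Dx_const; ring.
  - generalize along_near; apply locally_2d_weaken; intros u v H; apply H.
Qed.

Lemma DyDx_along :
  Dy (Dx (along h m p)) x y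
  = Dy (Dx m) x y * p x y + Dx m x y * Dy p x y + Dy m x y * Dx p x y
    + m x y * Dy (Dx p) x y.
Proof.
  rewrite (Dy_near _ (fun u v => hx + (Dx m u v * p u v + m u v * Dx p u v))).
  - rewrite (Dy_plus (fun _ _ => hx)) by C1_tac.
    rewrite Dy_plus by C1_tac; rewrite !Dy_mult by C1_tac.
    rewrite Dy_const; ring.
  - generalize along_near; apply locally_2d_weaken; intros u v H; apply H.
Qed.

Lemma DyDy_along :
  Dy (Dy (along h m p)) x y
  = Dy (Dy m) x y * p x y + 2 * Dy m x y * Dy p x y + m x y * Dy (Dy p) x y.
Proof.
  rewrite (Dy_near _ (fun u v => hy + (Dy m u v * p u v + m u v * Dy p u v))).
  - rewrite (Dy_plus (fun _ _ => hy)) by C1_tac.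
    rewrite Dy_plus by C1_tac; rewrite !Dy_mult by C1_tac.
    rewrite Dy_const; ring.
  - generalize along_near; apply locally_2d_weaken; intros u v H; apply H.
Qed.

End Along.

Definition diff1 (g : R -> R -> R) (x y : R) (v : R * R) : R :=
  Dx g x y * fst v + Dy g x y * snd v.

(** At C^2 points [Dy (Dx g)] stands for both mixed derivatives. *)
Definition hess (g : R -> R -> R) (x y : R) (v w : R * R) : R :=
  Dx (Dx g) x y * (fst v * fst w)
  + Dy (Dx g) x y * (fst v * snd w + snd v * fst w)
  + Dy (Dy g) x y * (snd v * snd w).

Section Sheet.

Variables (xi1 xi2 m : R -> R -> R) (x y : R).
Hypotheses (H1 : Cn_near 2 xi1 x y) (H2 : Cn_near 2 xi2 x y)
  (Hm : Cn_near 2 m x y).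

Let dcst (c u v : R) :
  is_derive (fun _ => c) u 0 /\ is_derive (fun _ => c) v 0.
Proof. split; apply @is_derive_const. Qed.

Let dfst (u v : R) :
  is_derive (fun t : R => t) u 1 /\ is_derive (fun _ => u) v 0.
Proof. split; [apply @is_derive_id | apply @is_derive_const]. Qed.

Let dsnd (u v : R) :
  is_derive (fun _ => v) u 0 /\ is_derive (fun t : R => t) v 1.
Proof. split; [apply @is_derive_const | apply @is_derive_id]. Qed.

Let Cone : Cn_near 2 (fun _ _ => 1) x y.
Proof. apply Cn_near_const. Qed.

Lemma VDx_sheet :
  VDx (sheet xi1 xi2 m) x y =
  (1 + m x y * Dx xi1 x y + Dx m x y * xi1 x y,
   m x y * Dx xi2 x y + Dx m x y * xi2 x y, Dx m x y).
Proof.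
  unfold VDx; f_equal; [f_equal |].
  - change (Dx (along (fun u _ => u) m xi1) x y
            = 1 + m x y * Dx xi1 x y + Dx m x y * xi1 x y).
    rewrite (Dx_along (fun u _ => u) _ _ _ _ 1 0 dfst Hm H1); ring.
  - change (Dx (along (fun _ v => v) m xi2) x y
            = m x y * Dx xi2 x y + Dx m x y * xi2 x y).
    rewrite (Dx_along (fun _ v => v) _ _ _ _ 0 1 dsnd Hm H2); ring.
  - change (Dx (along (fun _ _ => 0) m (fun _ _ => 1)) x y = Dx m x y).
    rewrite (Dx_along (fun _ _ => 0) _ _ _ _ 0 0 (dcst 0) Hm Cone), Dx_const; ring.
Qed.

Lemma VDy_sheet :
  VDy (sheet xi1 xi2 m) x y =
  (m x y * Dy xi1 x y + Dy m x y * xi1 x y,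
   1 + m x y * Dy xi2 x y + Dy m x y * xi2 x y, Dy m x y).
Proof.
  unfold VDy; f_equal; [f_equal |].
  - change (Dy (along (fun u _ => u) m xi1) x y
            = m x y * Dy xi1 x y + Dy m x y * xi1 x y).
    rewrite (Dy_along (fun u _ => u) _ _ _ _ 1 0 dfst Hm H1); ring.
  - change (Dy (along (fun _ v => v) m xi2) x y
            = 1 + m x y * Dy xi2 x y + Dy m x y * xi2 x y).
    rewrite (Dy_along (fun _ v => v) _ _ _ _ 0 1 dsnd Hm H2); ring.
  - change (Dy (along (fun _ _ => 0) m (fun _ _ => 1)) x y = Dy m x y).
    rewrite (Dy_along (fun _ _ => 0) _ _ _ _ 0 0 (dcst 0) Hm Cone), Dy_const; ring.
Qed.

Lemma second_diff_component h p (hx hy : R) (v : R * R) :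
  (forall s t,
     is_derive (fun z => h z t) s hx /\ is_derive (fun z => h s z) t hy) ->
  Cn_near 2 p x y ->
  fst v ^ 2 * Dx (Dx (along h m p)) x y
  + (2 * fst v * snd v * Dy (Dx (along h m p)) x y
     + snd v ^ 2 * Dy (Dy (along h m p)) x y)
  = 2 * diff1 m x y v * diff1 p x y v + m x y * hess p x y v v
    + hess m x y v v * p x y.
Proof.
  intros Dh Hp.
  rewrite (DxDx_along _ _ _ _ _ _ _ Dh Hm Hp).
  rewrite (DyDx_along _ _ _ _ _ _ _ Dh Hm Hp).
  rewrite (DyDy_along _ _ _ _ _ _ _ Dh Hm Hp).
  unfold diff1, hess; ring.
Qed.

(** The second differential of [m] multiplies the direction of the line and
    nothing else. The third coordinate obeys the same rule as the other two,
    with constant direction component 1. *)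
Lemma second_diff_sheet (v : R * R) :
  second_diff (sheet xi1 xi2 m) x y v =
  (2 * diff1 m x y v * diff1 xi1 x y v + m x y * hess xi1 x y v v
     + hess m x y v v * xi1 x y,
   2 * diff1 m x y v * diff1 xi2 x y v + m x y * hess xi2 x y v v
     + hess m x y v v * xi2 x y,
   hess m x y v v).
Proof.
  rewrite <- (second_diff_component (fun u _ => u) _ _ _ v dfst H1).
  rewrite <- (second_diff_component (fun _ v => v) _ _ _ v dsnd H2).
  replace (hess m x y v v) with
    (2 * diff1 m x y v * diff1 (fun _ _ => 1) x y v
     + m x y * hess (fun _ _ => 1) x y v v + hess m x y v v * 1).
  - rewrite <- (second_diff_component (fun _ _ => 0) (fun _ _ => 1) 0 0 v
                 (dcst 0) Cone).
    reflexivity.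
  - unfold diff1, hess; rewrite Dx_const, Dy_const.
    rewrite (Dx_near (Dx (fun _ _ => 1)) (fun _ _ => 0)),
      (Dy_near (Dx (fun _ _ => 1)) (fun _ _ => 0)),
      (Dy_near (Dy (fun _ _ => 1)) (fun _ _ => 0))
      by (apply locally_2d_forall; intros; apply Dx_const || apply Dy_const).
    rewrite ?Dx_const, ?Dy_const; ring.
Qed.

End Sheet.

(** * The characteristic equation and the principal directions *)

Definition wedge (v w : R * R) : R := fst v * snd w - snd v * fst w.

(** The characteristic equation of the shape operator, kept as a condition at a
    point so that it can be imposed near a point and differentiated. *)
Definition char_eq (xi1 xi2 l : R -> R -> R) (u v : R) : Prop :=
  l u v ^ 2 - (Sa xi1 xi2 u v + Sd xi1 xi2 u v) * l u v
  + (Sa xi1 xi2 u v * Sd xi1 xi2 u v - Sb xi1 xi2 u v * Sc xi1 xi2 u v) = 0.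

Definition eigenvector (a b c d l : R) (r : R * R) : Prop :=
  a * fst r + b * snd r = l * fst r /\ c * fst r + d * snd r = l * snd r.

(** Two distinct real eigenvalues give a principal basis. Normalising its
    determinant to 1 makes [wedge v s] and [wedge r v] the coordinates of [v]
    in it, with no denominators. *)
Lemma eigenbasis_exists (a b c d l1 l2 : R) :
  l1 <> l2 -> l1 + l2 = a + d -> l1 * l2 = a * d - b * c ->
  exists r s : R * R,
    eigenvector a b c d l1 r /\ eigenvector a b c d l2 s /\ wedge r s = 1.
Proof.
  intros Hne Hs Hp; unfold eigenvector, wedge.
  assert (Hd : d = l1 + l2 - a) by lra; subst d; clear Hs.
  destruct (Req_dec b 0) as [Hb | Hb].
  - destruct (Req_dec c 0) as [Hc | Hc].
    + subst b c.
      assert (Hf : (a - l1) * (a - l2) = 0) by lra.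
      apply Rmult_integral in Hf; destruct Hf as [Hf | Hf].
      * exists (1, 0), (0, 1); simpl; repeat split; lra.
      * exists (0, 1), (-1, 0); simpl; repeat split; lra.
    + (* Cayley-Hamilton: the columns of S - l2 are eigenvectors for l1 and
         those of S - l1 for l2. *)
      exists (a - l2, c), ((a - l1) / (c * (l1 - l2)), / (l1 - l2)); simpl.
      assert (l1 - l2 <> 0) by lra.
      assert (Hq : b * c = a * (l1 + l2 - a) - l1 * l2) by lra.
      repeat split.
      * ring_simplify; replace (a * (a - l2)) with (a ^ 2 - a * l2) by ring; lra.
      * ring.
      * apply (Rmult_eq_reg_r (c * (l1 - l2)));
          [field_simplify; trivial; lra | apply Rmult_integral_contrapositive; tauto].
      * field; tauto.
      * field; tauto.
  - (* (b, l - a) solves the first row of the eigenvector equation. *)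
    exists (b, l1 - a), (- / (l1 - l2), - (l2 - a) / (b * (l1 - l2))); simpl.
    assert (l1 - l2 <> 0) by lra.
    assert (Hq : b * c = a * (l1 + l2 - a) - l1 * l2) by lra.
    repeat split.
    + ring.
    + ring_simplify; replace (l1 * (l1 - a)) with (l1 ^ 2 - l1 * a) by ring; lra.
    + field; tauto.
    + apply (Rmult_eq_reg_r (b * (l1 - l2)));
        [field_simplify; trivial; lra | apply Rmult_integral_contrapositive; tauto].
    + field; tauto.
Qed.

(** The matrix minus [l] is [l' - l] times the projection onto the line of [s]
    along [r]; these are its entries in terms of the principal basis. *)
Lemma eigenbasis_matrix (a b c d l l' : R) (r s : R * R) :
  eigenvector a b c d l r -> eigenvector a b c d l' s -> wedge r s = 1 ->
  l - a = - (l - l') * (snd r * fst s) /\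
  b = - (l - l') * (fst r * fst s) /\
  c = (l - l') * (snd r * snd s) /\
  l - d = (l - l') * (fst r * snd s).
Proof.
  destruct r as [r1 r2], s as [s1 s2]; unfold eigenvector, wedge; simpl.
  intros [E1 E2] [E3 E4] E5.
  assert (Ea : a = l * r1 * s2 - l' * s1 * r2).
  { transitivity (a * (r1 * s2 - r2 * s1)); [rewrite E5; ring |].
    replace (a * (r1 * s2 - r2 * s1))
      with ((a * r1 + b * r2) * s2 - (a * s1 + b * s2) * r2) by ring.
    rewrite E1, E3; ring. }
  assert (Eb : b = - (l * r1 * s1) + l' * s1 * r1).
  { transitivity (b * (r1 * s2 - r2 * s1)); [rewrite E5; ring |].
    replace (b * (r1 * s2 - r2 * s1))
      with ((a * s1 + b * s2) * r1 - (a * r1 + b * r2) * s1) by ring.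
    rewrite E1, E3; ring. }
  assert (Ec : c = l * r2 * s2 - l' * s2 * r2).
  { transitivity (c * (r1 * s2 - r2 * s1)); [rewrite E5; ring |].
    replace (c * (r1 * s2 - r2 * s1))
      with ((c * r1 + d * r2) * s2 - (c * s1 + d * s2) * r2) by ring.
    rewrite E2, E4; ring. }
  assert (Ed : d = - (l * r2 * s1) + l' * s2 * r1).
  { transitivity (d * (r1 * s2 - r2 * s1)); [rewrite E5; ring |].
    replace (d * (r1 * s2 - r2 * s1))
      with ((c * s1 + d * s2) * r1 - (c * r1 + d * r2) * s1) by ring.
    rewrite E2, E4; ring. }
  assert (El : l = l * (r1 * s2 - r2 * s1)) by (rewrite E5; ring).
  repeat split; [rewrite El at 1; rewrite Ea | rewrite Eb | rewrite Ec
                | rewrite El at 1; rewrite Ed]; ring.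
Qed.

(** Implicit differentiation of the characteristic equation along a coordinate
    line; [p], [q], [e], [f] are the entries of the Jacobian matrix of the
    direction map, which is the opposite of the shape operator. The factor of
    [dl] is the difference of the two eigenvalues. *)
Lemma char_eq_derive (l p q e f : R -> R) (t dl dp dq de df : R) :
  is_derive l t dl -> is_derive p t dp -> is_derive q t dq ->
  is_derive e t de -> is_derive f t df ->
  locally t (fun z => l z ^ 2 - (- p z + - f z) * l z
                      + (- p z * - f z - - q z * - e z) = 0) ->
  dl * (2 * l t + p t + f t)
  = - ((dp + df) * l t + (dp * f t + p t * df - dq * e t - q t * de)).
Proof.
  intros Hl Hp Hq He Hf Hz.
  set (G := fun z => l z ^ 2 - (- p z + - f z) * l z
                     + (- p z * - f z - - q z * - e z)) in Hz.
  assert (H0 : is_derive G t 0).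
  { apply (is_derive_ext_loc (fun _ => 0)); [| apply @is_derive_const].
    revert Hz; apply filter_imp; intros z Hz; symmetry; exact Hz. }
  assert (H1 : is_derive G t
    (dl * (2 * l t + p t + f t)
     + ((dp + df) * l t + (dp * f t + p t * df - dq * e t - q t * de)))).
  { unfold G; auto_derive.
    - repeat split; eexists; eassumption.
    - replace (Derive (fun z => l z) t) with dl
        by (symmetry; apply is_derive_unique; exact Hl).
      replace (Derive (fun z => p z) t) with dp
        by (symmetry; apply is_derive_unique; exact Hp).
      replace (Derive (fun z => q z) t) with dq
        by (symmetry; apply is_derive_unique; exact Hq).
      replace (Derive (fun z => e z) t) with de
        by (symmetry; apply is_derive_unique; exact He).
      replace (Derive (fun z => f z) t) with df
        by (symmetry; apply is_derive_unique; exact Hf).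
      ring. }
  apply is_derive_unique in H0; apply is_derive_unique in H1; lra.
Qed.

(** The component of the second differential of the direction map transverse to
    [s]: for a principal direction [s] it is the pairing with the left
    eigenvector of the other eigenvalue. *)
Definition curv (xi1 xi2 : R -> R -> R) (x y : R) (s v w : R * R) : R :=
  wedge s (hess xi1 x y v w, hess xi2 x y v w).

Section Principal.

(* [l] is an eigenvalue field of the shape operator with principal direction
   [r]; [l'] and [s] are the other eigenvalue and direction at the point. *)

Variables (xi1 xi2 l : R -> R -> R) (x y l' : R) (r s : R * R).
Hypotheses (H1 : Cn_near 2 xi1 x y) (H2 : Cn_near 2 xi2 x y)
  (Hl : Cn_near 2 l x y)
  (Hchar : locally_2d (char_eq xi1 xi2 l) x y)
  (Hne : l x y <> l')
  (Hr : eigenvector (Sa xi1 xi2 x y) (Sb xi1 xi2 x y)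
          (Sc xi1 xi2 x y) (Sd xi1 xi2 x y) (l x y) r)
  (Hs : eigenvector (Sa xi1 xi2 x y) (Sb xi1 xi2 x y)
          (Sc xi1 xi2 x y) (Sd xi1 xi2 x y) l' s)
  (Hrs : wedge r s = 1).

Lemma principal_entries :
  l x y + Dx xi1 x y = - (l x y - l') * (snd r * fst s) /\
  Dy xi1 x y = (l x y - l') * (fst r * fst s) /\
  Dx xi2 x y = - (l x y - l') * (snd r * snd s) /\
  l x y + Dy xi2 x y = (l x y - l') * (fst r * snd s).
Proof.
  generalize (eigenbasis_matrix _ _ _ _ _ _ _ _ Hr Hs Hrs).
  unfold Sa, Sb, Sc, Sd; intros (E1 & E2 & E3 & E4); repeat split; lra.
Qed.

(** First-order perturbation of a simple eigenvalue: its derivative is the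
    derivative of the matrix, paired with the left and right eigenvectors. *)
Lemma Dx_root : Dx l x y = curv xi1 xi2 x y s (1, 0) r.
Proof.
  generalize principal_entries; intros (E1 & E2 & E3 & E4).
  assert (H := char_eq_derive (fun t => l t y)
    (fun t => Dx xi1 t y) (fun t => Dy xi1 t y)
    (fun t => Dx xi2 t y) (fun t => Dy xi2 t y) x
    (Dx l x y) (Dx (Dx xi1) x y) (Dy (Dx xi1) x y)
    (Dx (Dx xi2) x y) (Dy (Dx xi2) x y)).
  (* The mixed derivatives enter in the order Dx (Dy _) here. *)
  rewrite <- (Dx_Dy_comm xi1), <- (Dx_Dy_comm xi2) in H by assumption.
  assert (D1 : forall g, Cn_near 1 g x y ->
            is_derive (fun t => g t y) x (Dx g x y)).
  { intros g Hg; apply Derive_correct, (Cn_near_ex_derive 0), Hg. }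
  specialize (H (D1 _ (Cn_near_le 2 1 _ _ _ (le_S _ _ (le_n _)) Hl))
    (D1 _ (Cn_near_Dx _ _ _ _ H1)) (D1 _ (Cn_near_Dy _ _ _ _ H1))
    (D1 _ (Cn_near_Dx _ _ _ _ H2)) (D1 _ (Cn_near_Dy _ _ _ _ H2))
    (locally_2d_1d_const_y _ _ _ Hchar)).
  simpl in H.
  rewrite (Dx_Dy_comm xi1), (Dx_Dy_comm xi2) in H by assumption.
  apply (Rmult_eq_reg_l (l x y - l')); [| lra].
  unfold curv, wedge, hess; simpl; unfold wedge in Hrs.
  replace (2 * l x y + Dx xi1 x y + Dy xi2 x y) with (l x y - l') in H.
  2:{ transitivity ((l x y - l') * (fst r * snd s - snd r * fst s));
      [rewrite Hrs; ring | lra]. }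
  rewrite Rmult_comm, H.
  transitivity (- (Dx (Dx xi1) x y * (l x y + Dy xi2 x y)
      + Dy (Dx xi2) x y * (l x y + Dx xi1 x y)
      - Dy (Dx xi1) x y * Dx xi2 x y - Dx (Dx xi2) x y * Dy xi1 x y));
    [ring |].
  rewrite E1, E2, E3, E4; ring.
Qed.

Lemma Dy_root : Dy l x y = curv xi1 xi2 x y s (0, 1) r.
Proof.
  generalize principal_entries; intros (E1 & E2 & E3 & E4).
  assert (D1 : forall g, Cn_near 1 g x y ->
            is_derive (fun t => g x t) y (Dy g x y)).
  { intros g Hg; apply Derive_correct, (Cn_near_ex_derive 0), Hg. }
  assert (H := char_eq_derive (fun t => l x t)
    (fun t => Dx xi1 x t) (fun t => Dy xi1 x t)
    (fun t => Dx xi2 x t) (fun t => Dy xi2 x t) y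
    (Dy l x y) (Dy (Dx xi1) x y) (Dy (Dy xi1) x y)
    (Dy (Dx xi2) x y) (Dy (Dy xi2) x y)
    (D1 _ (Cn_near_le 2 1 _ _ _ (le_S _ _ (le_n _)) Hl))
    (D1 _ (Cn_near_Dx _ _ _ _ H1)) (D1 _ (Cn_near_Dy _ _ _ _ H1))
    (D1 _ (Cn_near_Dx _ _ _ _ H2)) (D1 _ (Cn_near_Dy _ _ _ _ H2))
    (locally_2d_1d_const_x _ _ _ Hchar)).
  simpl in H.
  apply (Rmult_eq_reg_l (l x y - l')); [| lra].
  unfold curv, wedge, hess; simpl; unfold wedge in Hrs.
  replace (2 * l x y + Dx xi1 x y + Dy xi2 x y) with (l x y - l') in H.
  2:{ transitivity ((l x y - l') * (fst r * snd s - snd r * fst s));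
      [rewrite Hrs; ring | lra]. }
  rewrite Rmult_comm, H.
  transitivity (- (Dy (Dx xi1) x y * (l x y + Dy xi2 x y)
      + Dy (Dy xi2) x y * (l x y + Dx xi1 x y)
      - Dy (Dy xi1) x y * Dx xi2 x y - Dy (Dx xi2) x y * Dy xi1 x y));
    [ring |].
  rewrite E1, E2, E3, E4; ring.
Qed.

Lemma diff1_root (v : R * R) : diff1 l x y v = curv xi1 xi2 x y s v r.
Proof.
  unfold diff1; rewrite Dx_root, Dy_root.
  unfold curv, wedge, hess; simpl; ring.
Qed.

(** * The projective metric of a focal sheet in the principal directions *)

Hypothesis Hl0 : l x y <> 0.

Let m (u v : R) : R := 1 / l u v.

Lemma Cn_near_focal_distance : Cn_near 2 m x y.
Proof.
  apply Cn_near_mult; [apply Cn_near_const | apply Cn_near_inv; assumption].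
Qed.

Lemma Dx_focal_distance : Dx m x y = - Dx l x y / l x y ^ 2.
Proof.
  apply is_derive_unique; unfold m.
  apply (is_derive_ext (fun t => / l t y)); [intros t |].
  - exact (eq_sym (Rmult_1_l _)).
  - apply (is_derive_inv (fun t => l t y)); [| assumption].
    apply (is_derive_Dx 1), (locally_2d_singleton _ _ _ Hl).
Qed.

Lemma Dy_focal_distance : Dy m x y = - Dy l x y / l x y ^ 2.
Proof.
  apply is_derive_unique; unfold m.
  apply (is_derive_ext (fun t => / l x t)); [intros t |].
  - exact (eq_sym (Rmult_1_l _)).
  - apply (is_derive_inv (fun t => l x t)); [| assumption].
    apply (is_derive_Dy 1), (locally_2d_singleton _ _ _ Hl).
Qed.

(** The projective metric is diagonal in the principal basis. The differential
    of the focal point maps into the span of the line and [s], so the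
    determinant only sees the component of the second differential transverse
    to [s]. That component is, up to the factor [1 / l], [curv s v v] minus
    twice the product of the [r]-coordinate of [v] and [curv s v r], the second
    term coming from the derivative of [1 / l]. In coordinates of [v] the mixed
    terms cancel and the coefficient of the square of the [r]-coordinate
    changes sign. *)
Lemma proj_metric_focal (v : R * R) :
  proj_metric (sheet xi1 xi2 m) x y v
  = - ((l x y - l') * curv xi1 xi2 x y s r r / l x y ^ 4)
    * (wedge r v ^ 2 * curv xi1 xi2 x y s s s
       - wedge v s ^ 2 * curv xi1 xi2 x y s r r).
Proof.
  generalize principal_entries; intros (E1 & E2 & E3 & E4).
  unfold proj_metric.
  rewrite VDx_sheet, VDy_sheet, second_diff_sheet
    by (assumption || exact Cn_near_focal_distance).
  assert (Ev : v = (wedge v s * fst r + wedge r v * fst s,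
                    wedge v s * snd r + wedge r v * snd s)).
  { destruct v as [v1 v2]; unfold wedge in *; simpl in *; f_equal.
    - transitivity (v1 * (fst r * snd s - snd r * fst s)); [rewrite Hrs |]; ring.
    - transitivity (v2 * (fst r * snd s - snd r * fst s)); [rewrite Hrs |]; ring. }
  (* [k] is the nonzero eigenvalue of 1 - S / l, where S is the shape operator;
     [F1] to [F4] give the entries of that rank-one matrix. *)
  set (k := (l x y - l') / l x y).
  assert (F1 : 1 + m x y * Dx xi1 x y = - k * (snd r * fst s)).
  { replace (Dx xi1 x y) with (- (l x y - l') * (snd r * fst s) - l x y) by lra.
    unfold m, k; field; assumption. }
  assert (F2 : m x y * Dy xi1 x y = k * (fst r * fst s)).
  { rewrite E2; unfold m, k; field; assumption. }
  assert (F3 : m x y * Dx xi2 x y = - k * (snd r * snd s)).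
  { rewrite E3; unfold m, k; field; assumption. }
  assert (F4 : 1 + m x y * Dy xi2 x y = k * (fst r * snd s)).
  { replace (Dy xi2 x y) with ((l x y - l') * (fst r * snd s) - l x y) by lra.
    unfold m, k; field; assumption. }
  assert (Fm : forall w, diff1 m x y w
                 = - curv xi1 xi2 x y s w r / l x y ^ 2).
  { intros w; rewrite <- diff1_root; unfold diff1.
    rewrite Dx_focal_distance, Dy_focal_distance; field; assumption. }
  transitivity (k * diff1 m x y r
    * (2 * diff1 m x y v * wedge s (diff1 xi1 x y v, diff1 xi2 x y v)
       + m x y * curv xi1 xi2 x y s v v)).
  { unfold det3; rewrite F1, F2, F3, F4.
    unfold curv, wedge, diff1; cbn [fst snd]; ring. }
  assert (Fw : wedge s (diff1 xi1 x y v, diff1 xi2 x y v)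
               = l x y * wedge v s).
  { unfold wedge, diff1; simpl.
    replace (Dx xi1 x y) with (- (l x y - l') * (snd r * fst s) - l x y) by lra.
    replace (Dy xi2 x y) with ((l x y - l') * (fst r * snd s) - l x y) by lra.
    rewrite E2, E3; ring. }
  rewrite Fw, !Fm.
  assert (Expand : forall a b w,
    w = (a * fst r + b * fst s, a * snd r + b * snd s) ->
    curv xi1 xi2 x y s w r
      = a * curv xi1 xi2 x y s r r + b * curv xi1 xi2 x y s s r /\
    curv xi1 xi2 x y s w w
      = a ^ 2 * curv xi1 xi2 x y s r r + 2 * a * b * curv xi1 xi2 x y s s r
        + b ^ 2 * curv xi1 xi2 x y s s s).
  { intros a b w ->; unfold curv, wedge, hess; cbn [fst snd]; split; ring. }
  destruct (Expand _ _ _ Ev) as [-> ->].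
  unfold k, m; field; assumption.
Qed.

(** Since [r] is in the kernel of 1 - S / l, S being the shape operator, the
    focal point moves along [r] in the direction of the line, at the rate of
    the focal distance [1 / l]. If [curv s r r] vanished, so would the
    derivative of [l] along [r], and the focal set would be singular. *)
Lemma immersion_curv :
  immersion_at (sheet xi1 xi2 m) x y -> curv xi1 xi2 x y s r r <> 0.
Proof.
  intros Himm Hz.
  generalize principal_entries; intros (E1 & E2 & E3 & E4).
  assert (Hd : Dx m x y * fst r + Dy m x y * snd r = 0).
  { rewrite Dx_focal_distance, Dy_focal_distance.
    transitivity (- diff1 l x y r / l x y ^ 2).
    - unfold diff1; field; assumption.
    - rewrite diff1_root, Hz; field; assumption. }
  destruct (Himm (fst r) (snd r)) as [R1 R2].
  - rewrite VDx_sheet, VDy_sheet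
      by (assumption || exact Cn_near_focal_distance).
    destruct Hr as [Hr1 Hr2]; unfold Sa, Sb, Sc, Sd in Hr1, Hr2.
    assert (Nr1 : fst r + m x y * (Dx xi1 x y * fst r + Dy xi1 x y * snd r) = 0).
    { replace (Dx xi1 x y * fst r + Dy xi1 x y * snd r)
        with (- (l x y * fst r)) by lra.
      unfold m; field; assumption. }
    assert (Nr2 : snd r + m x y * (Dx xi2 x y * fst r + Dy xi2 x y * snd r) = 0).
    { replace (Dx xi2 x y * fst r + Dy xi2 x y * snd r)
        with (- (l x y * snd r)) by lra.
      unfold m; field; assumption. }
    apply injective_projections; [apply injective_projections |];
      unfold plus, scal; simpl; unfold plus, scal; simpl;
      unfold mult; simpl.
    + transitivity (fst r + m x y * (Dx xi1 x y * fst r + Dy xi1 x y * snd r)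
        + (Dx m x y * fst r + Dy m x y * snd r) * xi1 x y); [ring |].
      rewrite Nr1, Hd; ring.
    + transitivity (snd r + m x y * (Dx xi2 x y * fst r + Dy xi2 x y * snd r)
        + (Dx m x y * fst r + Dy m x y * snd r) * xi2 x y); [ring |].
      rewrite Nr2, Hd; ring.
    + lra.
  - unfold wedge in Hrs; rewrite R1, R2 in Hrs; lra.
Qed.

End Principal.

(** * The Weingarten condition *)

Lemma smooth_on_Cn_near (D : R * R -> Prop) (g : R -> R -> R) (n : nat) (x y : R) :
  open D -> smooth_on D g -> D (x, y) -> Cn_near n g x y.
Proof.
  intros hD hg hxy; apply locally_2d_locally.
  generalize (hD _ hxy); apply filter_imp.
  intros [u v] Huv; apply hg, Huv.
Qed.

Section Roots.

Variables (xi1 xi2 : R -> R -> R) (x y : R).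
Hypotheses (H1 : Cn_near 3 xi1 x y) (H2 : Cn_near 3 xi2 x y)
  (Hd : 0 < discr xi1 xi2 x y).

Lemma Cn_near_entries :
  Cn_near 2 (Sa xi1 xi2) x y /\ Cn_near 2 (Sb xi1 xi2) x y /\
  Cn_near 2 (Sc xi1 xi2) x y /\ Cn_near 2 (Sd xi1 xi2) x y.
Proof.
  repeat split; apply Cn_near_opp; (apply Cn_near_Dx || apply Cn_near_Dy);
    assumption.
Qed.

Lemma Cn_near_discr : Cn_near 2 (discr xi1 xi2) x y.
Proof.
  destruct Cn_near_entries as (Ha & Hb & Hc & Hd').
  apply (Cn_near_ext _ (fun u v =>
    (Sa xi1 xi2 u v + - Sd xi1 xi2 u v) * (Sa xi1 xi2 u v + - Sd xi1 xi2 u v)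
    + 4 * Sb xi1 xi2 u v * Sc xi1 xi2 u v)).
  - apply locally_2d_forall; intros u v; unfold discr; ring.
  - repeat first [ assumption | apply Cn_near_const | apply Cn_near_plus
                 | apply Cn_near_mult | apply Cn_near_opp ].
Qed.

Lemma Cn_near_sqrt_discr :
  Cn_near 2 (fun u v => sqrt (discr xi1 xi2 u v)) x y.
Proof. apply Cn_near_sqrt; [exact Hd | exact Cn_near_discr]. Qed.

Lemma Cn_near_lambda :
  Cn_near 2 (lambda1 xi1 xi2) x y /\ Cn_near 2 (lambda2 xi1 xi2) x y.
Proof.
  destruct Cn_near_entries as (Ha & Hb & Hc & Hd').
  split; apply Cn_near_mult; try apply Cn_near_const;
    apply Cn_near_plus; try (apply Cn_near_plus; assumption);
    try apply Cn_near_opp; exact Cn_near_sqrt_discr.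
Qed.

Lemma lambda_sum u v :
  lambda1 xi1 xi2 u v + lambda2 xi1 xi2 u v = Sa xi1 xi2 u v + Sd xi1 xi2 u v.
Proof. unfold lambda1, lambda2; field. Qed.

Lemma lambda_prod u v : 0 <= discr xi1 xi2 u v ->
  lambda1 xi1 xi2 u v * lambda2 xi1 xi2 u v
  = Sa xi1 xi2 u v * Sd xi1 xi2 u v - Sb xi1 xi2 u v * Sc xi1 xi2 u v.
Proof.
  intros H; unfold lambda1, lambda2.
  generalize (sqrt_sqrt _ H); set (q := sqrt _); intros Hq.
  transitivity (/ 4 * ((Sa xi1 xi2 u v + Sd xi1 xi2 u v) ^ 2 - q * q)); [field |].
  rewrite Hq; unfold discr; field.
Qed.

Lemma char_eq_lambda :
  locally_2d (char_eq xi1 xi2 (lambda1 xi1 xi2)) x y /\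
  locally_2d (char_eq xi1 xi2 (lambda2 xi1 xi2)) x y.
Proof.
  assert (H : locally_2d (fun u v => 0 < discr xi1 xi2 u v) x y).
  { apply continuity_2d_pt_pos; [| exact Hd].
    apply (Cn_near_continuity 2), Cn_near_discr. }
  split; revert H; apply locally_2d_weaken; intros u v H; unfold char_eq;
    rewrite <- lambda_sum, <- lambda_prod by lra; ring.
Qed.

Lemma lambda_neq : lambda1 xi1 xi2 x y <> lambda2 xi1 xi2 x y.
Proof.
  unfold lambda1, lambda2; pose proof (sqrt_lt_R0 _ Hd); lra.
Qed.

End Roots.

(** Up to a constant, [W] is the determinant formed by the second differentials of the two
    direction components and the quadratic form [wedge v (S v)], where [S] is
    the shape operator. That form is a multiple of the product of the two
    principal coordinates, so only the second derivatives along [r, r] and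
    [s, s] remain. *)
Lemma W_principal (xi1 xi2 : R -> R -> R) (x y l l' : R) (r s : R * R) :
  eigenvector (Sa xi1 xi2 x y) (Sb xi1 xi2 x y)
    (Sc xi1 xi2 x y) (Sd xi1 xi2 x y) l r ->
  eigenvector (Sa xi1 xi2 x y) (Sb xi1 xi2 x y)
    (Sc xi1 xi2 x y) (Sd xi1 xi2 x y) l' s ->
  wedge r s = 1 ->
  W xi1 xi2 x y
  = (l - l') * (curv xi1 xi2 x y s r r * curv xi1 xi2 x y r s s
                - curv xi1 xi2 x y s s s * curv xi1 xi2 x y r r r).
Proof.
  intros Hr Hs Hrs.
  destruct (eigenbasis_matrix _ _ _ _ _ _ _ _ Hr Hs Hrs) as (E1 & E2 & E3 & E4).
  unfold Sa, Sb, Sc, Sd in E1, E2, E3, E4.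
  transitivity (W xi1 xi2 x y * wedge r s ^ 2); [rewrite Hrs; ring |].
  unfold W.
  replace (Dy xi2 x y - Dx xi1 x y)
    with ((l - l') * (snd r * fst s + fst r * snd s)) by lra.
  replace (Dy xi1 x y) with ((l - l') * (fst r * fst s)) by lra.
  replace (Dx xi2 x y) with (- (l - l') * (snd r * snd s)) by lra.
  unfold curv, wedge, hess; cbn [fst snd]; ring.
Qed.

(** Two nonzero diagonal forms are proportional when the determinant of their
    coefficients vanishes. Each form has a coefficient known to be nonzero, [p]
    for [F] and [q'] for [G]; this forces the factor to be nonzero as well. *)
Lemma proportional_diagonal_forms (F G a b : R * R -> R) (K L p q p' q' : R)
  (u w : R * R) :
  a u = 0 -> b u = 1 -> a w = 1 -> b w = 0 ->
  K <> 0 -> L <> 0 -> p <> 0 -> q' <> 0 ->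
  (forall v, F v = K * (a v ^ 2 * q - b v ^ 2 * p)) ->
  (forall v, G v = L * (a v ^ 2 * q' - b v ^ 2 * p')) ->
  (exists k : R, k <> 0 /\ forall v, F v = k * G v) <-> p * q' - q * p' = 0.
Proof.
  intros au bu aw bw HK HL Hp Hq HF HG; split.
  - intros (k & Hk & H).
    pose proof (H u) as Hu; pose proof (H w) as Hw.
    rewrite HF, HG, au, bu in Hu; rewrite HF, HG, aw, bw in Hw.
    assert (Ep : p = k * L * p' / K).
    { apply (Rmult_eq_reg_l K); [| exact HK].
      transitivity (k * L * p'); [lra | field; exact HK]. }
    assert (Eq : q = k * L * q' / K).
    { apply (Rmult_eq_reg_l K); [| exact HK].
      transitivity (k * L * q'); [lra | field; exact HK]. }
    rewrite Ep, Eq; field; exact HK.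
  - intros H.
    assert (Hp' : p' <> 0).
    { intros E; rewrite E in H; apply (Rmult_integral_contrapositive p q');
        [split; assumption | lra]. }
    exists (K * p / (L * p')); split.
    + unfold Rdiv; repeat apply Rmult_integral_contrapositive_currified;
        trivial; apply Rinv_neq_0_compat, Rmult_integral_contrapositive_currified;
        assumption.
    + intros v; rewrite HF, HG.
      transitivity (K / p' * (a v ^ 2 * (q * p') - b v ^ 2 * p * p'));
        [field; assumption |].
      replace (q * p') with (p * q') by lra; field; tauto.
Qed.

Lemma curv_opp xi1 xi2 x y s v w :
  curv xi1 xi2 x y (- fst s, - snd s) v w = - curv xi1 xi2 x y s v w.
Proof. unfold curv, wedge; cbn [fst snd]; ring. Qed.

Lemma curv_opp_opp xi1 xi2 x y s v :
  curv xi1 xi2 x y s (- fst v, - snd v) (- fst v, - snd v)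
  = curv xi1 xi2 x y s v v.
Proof. unfold curv, wedge, hess; cbn [fst snd]; ring. Qed.

Theorem corollary2p11 (D : R * R -> Prop) (xi1 xi2 : R -> R -> R)
  (hD : open D)
  (hxi1 : smooth_on D xi1) (hxi2 : smooth_on D xi2)
  (x y : R) (hxy : D (x, y))
  (hlambda1 : lambda1 xi1 xi2 x y <> 0)
  (hlambda2 : lambda2 xi1 xi2 x y <> 0)
  (hreg : regular_point xi1 xi2 x y) :
  weingarten_at xi1 xi2 x y <-> W xi1 xi2 x y = 0.
Proof.
  destruct hreg as (Hd & Him1 & Him2).
  assert (C3 : Cn_near 3 xi1 x y) by (apply (smooth_on_Cn_near D); assumption).
  assert (C3' : Cn_near 3 xi2 x y) by (apply (smooth_on_Cn_near D); assumption).
  assert (C2 : Cn_near 2 xi1 x y) by (apply (smooth_on_Cn_near D); assumption).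
  assert (C2' : Cn_near 2 xi2 x y) by (apply (smooth_on_Cn_near D); assumption).
  destruct (Cn_near_lambda _ _ _ _ C3 C3' Hd) as [Cl1 Cl2].
  destruct (char_eq_lambda _ _ _ _ C3 C3' Hd) as [Ch1 Ch2].
  pose proof (lambda_neq _ _ _ _ Hd) as Hne.
  destruct (eigenbasis_exists _ _ _ _ _ _ Hne (lambda_sum xi1 xi2 x y)
    (lambda_prod xi1 xi2 x y (Rlt_le _ _ Hd))) as (r & s & Hr & Hs & Hrs).
  (* For the second sheet the principal basis is (s, r'); the sign makes its
     determinant 1 again. *)
  set (r' := (- fst r, - snd r)).
  assert (Hr' : eigenvector (Sa xi1 xi2 x y) (Sb xi1 xi2 x y)
    (Sc xi1 xi2 x y) (Sd xi1 xi2 x y) (lambda1 xi1 xi2 x y) r').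
  { destruct Hr; split; simpl; lra. }
  assert (Hsr' : wedge s r' = 1).
  { revert Hrs; unfold wedge, r'; simpl; lra. }
  pose proof (immersion_curv _ _ _ _ _ _ _ _ C2 C2' Cl1 Ch1 Hne
    Hr Hs Hrs hlambda1 Him1) as HB1.
  pose proof (immersion_curv _ _ _ _ _ _ _ _ C2 C2' Cl2 Ch2 (not_eq_sym Hne)
    Hs Hr' Hsr' hlambda2 Him2) as HB2.
  pose proof (proj_metric_focal _ _ _ _ _ _ _ _ C2 C2' Cl1 Ch1 Hne
    Hr Hs Hrs hlambda1) as M1.
  pose proof (proj_metric_focal _ _ _ _ _ _ _ _ C2 C2' Cl2 Ch2 (not_eq_sym Hne)
    Hs Hr' Hsr' hlambda2) as M2.
  unfold r' in HB2, M2.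
  rewrite (curv_opp xi1 xi2) in HB2.
  rewrite (W_principal _ _ _ _ _ _ _ _ Hr Hs Hrs).
  set (l1 := lambda1 xi1 xi2 x y) in *; set (l2 := lambda2 xi1 xi2 x y) in *.
  set (p := curv xi1 xi2 x y s r r) in *; set (q := curv xi1 xi2 x y s s s) in *.
  set (q' := curv xi1 xi2 x y r s s) in *; set (p' := curv xi1 xi2 x y r r r) in *.
  transitivity (p * q' - q * p' = 0).
  2:{ split; intros H; [rewrite H; ring |].
      apply Rmult_integral in H; destruct H as [H | H]; [lra | exact H]. }
  assert (P4 : forall l, l <> 0 -> / l ^ 4 <> 0).
  { intros l Hl; apply Rinv_neq_0_compat, pow_nonzero, Hl. }
  apply (proportional_diagonal_forms _ _ (wedge r) (fun v => wedge v s)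
    (- ((l1 - l2) * p / l1 ^ 4)) ((l2 - l1) * q' / l2 ^ 4) p q p' q' r s).
  - unfold wedge; ring.
  - exact Hrs.
  - exact Hrs.
  - unfold wedge; ring.
  - apply Ropp_neq_0_compat; unfold Rdiv.
    repeat apply Rmult_integral_contrapositive_currified; auto; lra.
  - unfold Rdiv.
    repeat apply Rmult_integral_contrapositive_currified; auto; lra.
  - exact HB1.
  - lra.
  - exact M1.
  - intros v.
    refine (eq_trans (M2 v) _).
    rewrite !(curv_opp xi1 xi2), (curv_opp_opp xi1 xi2).
    fold p' q'; unfold wedge; cbn [fst snd]; unfold Rdiv; ring.
Qed.
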